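(* Let $\varphi_0,\ldots,\varphi_{p+q}\colon\mathbb{R}^n\to\overline{\mathbb{R}}$, $I=\{1,\ldots,p\}$, $J=\{p+1,\ldots,p+q\}$, and consider the problem $$\min\{\varphi_0(z)\mid \varphi_i(z)\le 0\ (i\in I),\ \varphi_i(z)=0\ (i\in J)\}.$$ Let $\bar z$ be a feasible point of this problem such that $\varphi_0,\ldots,\varphi_{p+q}$ are locally Lipschitz continuous in a neighborhood of $\bar z$, let $I(\bar z)=\{i\in I\mid\varphi_i(\bar z)=0\}$, and assume that all functions $\varphi_i$ ($i\in I(\bar z)\cup J$) are piecewise affine in a neighborhood of $\bar z$. Then $\bar z$ is asymptotically $\partial^\square$-regular (A$\partial^\square$-regular), both for $\partial^\square=\partial$ (limiting subdifferential) and for $\partial^\square=\partial^{\mathrm c}$ (Clarke subdifferential).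
   Context: $\overline{\mathbb{R}}=\mathbb{R}\cup\{-\infty,\infty\}$. For a closed set $A\subset\mathbb{R}^n$ and $\bar z\in A$, the regular normal cone is $\widehat{\mathcal N}_A(\bar z)=\{\xi\mid \forall z\in A:\ \xi^\top(z-\bar z)\le o(\|z-\bar z\|)\}$ and the limiting normal cone is $\mathcal N_A(\bar z)=\limsup_{z\to\bar z,\,z\in A}\widehat{\mathcal N}_A(z)$. For a function $\psi$ that is locally Lipschitz continuous at $\bar z$, the limiting (Mordukhovich) subdifferential is $\partial\psi(\bar z)=\{\xi\mid(\xi,-1)\in\mathcal N_{\operatorname{epi}\psi}(\bar z,\psi(\bar z))\}$ and the Clarke subdifferential is $\partial^{\mathrm c}\psi(\bar z)=\operatorname{conv}\partial\psi(\bar z)$. Subdifferentials are only considered at points near which the function is Lipschitz continuous. The outer limit of a set-valued map $\Gamma$ at $\bar z$ is $\limsup_{z\to\bar z}\Gamma(z)=\{\xi\mid\exists z^k\to\bar z,\ \xi^k\to\xi,\ \xi^k\in\Gamma(z^k)\ \forall k\}$ (restricted to $z^k\in A$ when written $z\to\bar z$, $z\in A$). For a fixed feasible point $\bar z$ define, for $z\in\mathbb{R}^n$ (near $\bar z$), $$\overline{\mathcal M}^{\square}(z)=\bigcup_{\lambda_i\ge0\,(i\in I(\bar z)\cup J)}\Bigl[\sum_{i\in I(\bar z)}\lambda_i\,\partial^\square\varphi_i(z)+\sum_{i\in J}\lambda_i\bigl(\partial^\square\varphi_i(z)\cup\partial^\square(-\varphi_i)(z)\bigr)\Bigr].$$ The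 point $\bar z$ is A$\partial^\square$-regular if $\limsup_{z\to\bar z}\overline{\mathcal M}^\square(z)\subset\overline{\mathcal M}^\square(\bar z)$. *)

(* Defs.v *)
From HB Require Import structures.
From mathcomp Require Import all_boot all_order all_algebra.
From mathcomp Require Import all_classical all_reals all_analysis.

Set Implicit Arguments.
Unset Strict Implicit.
Unset Printing Implicit Defensive.

Import Order.TTheory GRing.Theory Num.Theory.
Import numFieldNormedType.Exports.

Local Open Scope classical_set_scope.
Local Open Scope ring_scope.

(* Vectors of R^n are row vectors, so u^T v is written u *m v^T. *)
Definition dotv (R : realType) (n : nat) (u v : 'rV[R]_n) : R :=
  (u *m v^T) 0 0.

Definition outer_limit (U V : topologicalType) (A : set U) (G : U -> set V)
    (zb : U) : set V :=
  [set xi | exists z_ : nat -> U, exists xi_ : nat -> V,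
     [/\ forall k, A (z_ k), z_ @ \oo --> zb, xi_ @ \oo --> xi
       & forall k, G (z_ k) (xi_ k)]].

(* The norm is the library norm of 'rV[R]_n, i.e. the sup norm; since all norms
   of R^n are equivalent, the o-term does not depend on this choice. *)
Definition regular_normal_cone (R : realType) (n : nat) (A : set 'rV[R]_n)
    (zb : 'rV[R]_n) : set 'rV[R]_n :=
  [set xi | A zb /\ forall e : R, 0 < e ->
     \forall z \near zb, A z -> dotv xi (z - zb) <= e * `|z - zb|].

Definition limiting_normal_cone (R : realType) (n : nat) (A : set 'rV[R]_n)
    (zb : 'rV[R]_n) : set 'rV[R]_n :=
  outer_limit A (regular_normal_cone A) zb.

(* The pair (z, a) of R^n x R is encoded as a vector of R^(n + 1). *)
Definition vpair (R : realType) (n : nat) (z : 'rV[R]_n) (a : R) :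
    'rV[R]_(n + 1) := row_mx z a%:M.

Definition epigraph (R : realType) (n : nat) (psi : 'rV[R]_n -> \bar R) :
    set 'rV[R]_(n + 1) :=
  [set w | exists z : 'rV[R]_n, exists a : R,
     w = vpair z a /\ (psi z <= a%:E)%E].

(* The two subdifferentials are only meaningful where psi is Lipschitz near z;
   there psi z is finite and fine (psi z) is its real value. *)
Definition limiting_subdiff (R : realType) (n : nat) (psi : 'rV[R]_n -> \bar R)
    (z : 'rV[R]_n) : set 'rV[R]_n :=
  [set xi | limiting_normal_cone (epigraph psi) (vpair z (fine (psi z)))
              (vpair xi (- 1))].

Definition conv_hull (R : realType) (n : nat) (S : set 'rV[R]_n) :
    set 'rV[R]_n :=
  [set xi | exists m : nat, exists t : 'I_m -> R, exists s : 'I_m -> 'rV[R]_n,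
     [/\ forall j, 0 <= t j, \sum_(j < m) t j = 1, forall j, S (s j)
       & xi = \sum_(j < m) t j *: s j]].

Definition clarke_subdiff (R : realType) (n : nat) (psi : 'rV[R]_n -> \bar R)
    (z : 'rV[R]_n) : set 'rV[R]_n :=
  conv_hull (limiting_subdiff psi z).

Definition locally_lipschitz_at (R : realType) (n : nat)
    (psi : 'rV[R]_n -> \bar R) (z : 'rV[R]_n) : Prop :=
  exists2 U : set 'rV[R]_n, nbhs z U &
    (forall x, U x -> psi x \is a fin_num)
    /\ [lipschitz (fine (psi x) : R^o) | x in U].

Definition polyhedral (R : realType) (n : nat) (P : set 'rV[R]_n) : Prop :=
  exists m : nat, exists a : 'I_m -> 'rV[R]_n, exists b : 'I_m -> R,
    P = [set x | forall j, dotv (a j) x <= b j].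

Definition piecewise_affine_near (R : realType) (n : nat)
    (psi : 'rV[R]_n -> \bar R) (zb : 'rV[R]_n) : Prop :=
  exists2 U : set 'rV[R]_n, nbhs zb U &
    exists N : nat, exists P : 'I_N -> set 'rV[R]_n,
    exists a : 'I_N -> 'rV[R]_n, exists b : 'I_N -> R,
      [/\ forall k, polyhedral (P k),
          forall x, U x -> exists k, P k x
        & forall k x, U x -> P k x -> psi x = (dotv (a k) x + b k)%:E].

Section Problem.
Variables (R : realType) (n p q : nat).
(* phi 0 is the objective; indices 1..p are the inequality constraints and
   p+1..p+q the equality constraints. *)
Variable phi : 'I_(p + q).+1 -> 'rV[R]_n -> \bar R.

Definition ineq_index (i : 'I_(p + q).+1) : bool := (0 < i <= p)%N.
Definition eq_index (i : 'I_(p + q).+1) : bool := (p < i)%N.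

Definition feasible (z : 'rV[R]_n) : Prop :=
  (forall i, ineq_index i -> (phi i z <= 0)%E)
  /\ (forall i, eq_index i -> phi i z = 0%E).

Definition active_index (zb : 'rV[R]_n) (i : 'I_(p + q).+1) : bool :=
  ineq_index i && (phi i zb == 0%E).

(* sd is the subdifferential operator, either limiting or Clarke. *)
Definition Mbar (sd : ('rV[R]_n -> \bar R) -> 'rV[R]_n -> set 'rV[R]_n)
    (zb z : 'rV[R]_n) : set 'rV[R]_n :=
  [set xi | exists lam : 'I_(p + q).+1 -> R,
            exists v : 'I_(p + q).+1 -> 'rV[R]_n,
     [/\ forall i, active_index zb i || eq_index i -> 0 <= lam i,
         forall i, active_index zb i -> sd (phi i) z (v i),
         forall i, eq_index i ->
           (sd (phi i) z `|` sd (fun x => (- phi i x)%E) z) (v i)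
       & xi = \sum_(i | active_index zb i) lam i *: v i
              + \sum_(i | eq_index i) lam i *: v i]].

Definition asymptotically_regular
    (sd : ('rV[R]_n -> \bar R) -> 'rV[R]_n -> set 'rV[R]_n)
    (zb : 'rV[R]_n) : Prop :=
  outer_limit setT (Mbar sd zb) zb `<=` Mbar sd zb zb.

End Problem.

(* Main.v *)
Require Import Defs.
From mathcomp Require Import all_boot all_order all_algebra.
From mathcomp Require Import all_classical all_reals all_analysis.
From mathcomp Require Import ring lra.

Set Implicit Arguments.
Unset Strict Implicit.
Unset Printing Implicit Defensive.
Import Order.TTheory GRing.Theory Num.Theory.
Import numFieldNormedType.Exports.
Local Open Scope classical_set_scope.
Local Open Scope ring_scope.

(** A piecewise affine function has only finitely many germs near zb: around
    a point x it is psi x plus a piecewise linear function of y - x, and this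
    function depends only on which polyhedra contain x and which of their
    inequalities are tight at x ([finite_germs]).  The regular normal cone to
    the epigraph at (x, psi x) is read off from the germ at x
    ([regular_normal_slope], [slope_regular_normal]), so that only finitely
    many regular subdifferentials, all of them closed, occur near zb.  The
    germs occurring in every neighbourhood of zb are the only ones left in a
    small one.  Hence, for z near zb, every limiting subgradient at z lies in
    the regular subdifferential of such a recurrent germ ([subdiff_slope]),
    and all of these are contained in the limiting subdifferential at zb
    ([recurrent_slope_subdiff]): the subdifferentials at nearby points are
    contained in the one at zb.

    It remains to pass to the limit in a sum of multipliers times
    subgradients, where the multipliers may be unbounded.  The cone over the
    regular subdifferential of a germ is the projection of a polyhedral cone,
    the multiplier being the eliminated variable, hence it is finitely
    generated ([slope_cone]).  Thus the cone over the limiting subdifferential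
    at zb is a finite union of finitely generated cones ([conic_limiting]).
    This is inherited by the convex hull, the cone over the convex hull of a
    union being the sum of the cones ([conic_conv_hull]), by unions, and by
    Minkowski sums ([ucone_sum]); and a finite union of finitely generated
    cones is closed ([closed_ucone]).  So the multiplier set at zb is closed
    and contains those at all nearby points, which is asymptotic regularity
    ([asymptotically_regular_conic]).

    The polyhedral facts needed (finitely generated cones and polyhedral cones
    are the same sets, Farkas' lemma) follow from the elimination of a single
    variable from a system of linear inequalities ([fourier_motzkin]). *)

(** * Finitely generated and polyhedral cones *)

Section Cones.
Variables (R : realType) (n : nat).
Local Notation V := 'rV[R]_n.
Implicit Types (x y a g : V) (s : seq V).

Lemma dotvE x y : dotv x y = \sum_j x 0 j * y 0 j.
Proof. by rewrite /dotv mxE; apply: eq_bigr => j _; rewrite mxE. Qed.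

Lemma dotvC x y : dotv x y = dotv y x.
Proof. by rewrite !dotvE; apply: eq_bigr => j _; rewrite mulrC. Qed.

Lemma dotvDl x y a : dotv (x + y) a = dotv x a + dotv y a.
Proof. by rewrite /dotv mulmxDl mxE. Qed.

Lemma dotvZl t x a : dotv (t *: x) a = t * dotv x a.
Proof. by rewrite /dotv -scalemxAl mxE. Qed.

Lemma dotvNl x a : dotv (- x) a = - dotv x a.
Proof. by rewrite /dotv mulNmx mxE. Qed.

Lemma dotv0l a : dotv 0 a = 0.
Proof. by rewrite /dotv mul0mx mxE. Qed.

Lemma dotvDr a x y : dotv a (x + y) = dotv a x + dotv a y.
Proof. by rewrite dotvC dotvDl !(dotvC a). Qed.

Lemma dotvZr a t x : dotv a (t *: x) = t * dotv a x.
Proof. by rewrite dotvC dotvZl dotvC. Qed.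

Lemma dotvNr a x : dotv a (- x) = - dotv a x.
Proof. by rewrite dotvC dotvNl dotvC. Qed.

Lemma dotv0r a : dotv a 0 = 0.
Proof. by rewrite dotvC dotv0l. Qed.

Lemma dotv_self_le0 x : dotv x x <= 0 -> x = 0.
Proof.
rewrite dotvE => x0; apply/rowP => j; rewrite [RHS]mxE.
have sq k : true -> 0 <= x 0 k * x 0 k by move=> _; rewrite -expr2 sqr_ge0.
have /eqP : \sum_k x 0 k * x 0 k = 0.
  by apply/eqP; rewrite eq_le x0 sumr_ge0.
rewrite psumr_eq0// => /allP/(_ j (mem_index_enum _)) /=.
by rewrite mulf_eq0 orbb => /eqP.
Qed.

Definition polar s : set V := [set y | forall a, a \in s -> dotv a y <= 0].

(** The cone of nonnegative combinations of [s]. The recursion adds one ray at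
    a time, so that a single elimination step handles each generator. *)
Fixpoint cone s : set V :=
  if s is a :: s' then [set x | exists2 t, 0 <= t & cone s' (x - t *: a)]
  else [set 0].

Lemma cone0 s : cone s 0.
Proof.
by elim: s => //= a s IH; exists 0 => //; rewrite scale0r subr0.
Qed.

Lemma cone_cat s1 s2 x :
  cone (s1 ++ s2) x <-> exists y z, [/\ cone s1 y, cone s2 z & x = y + z].
Proof.
elim: s1 x => [|a s IH] x /=.
  split=> [h|[y [z [-> h ->]]]]; last by rewrite add0r.
  by exists 0, x; rewrite add0r.
split=> [[t t0 /IH [y [z [hy hz /eqP]]]]|[y [z [[t t0 hy] hz ->]]]].
  rewrite subr_eq => /eqP ->; exists (y + t *: a), z; split => //.
    by exists t => //; rewrite addrK.
  by rewrite addrAC.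
by exists t => //; apply/IH; exists (y - t *: a), z; split => //; rewrite addrAC.
Qed.

Lemma coneD s x y : cone s x -> cone s y -> cone s (x + y).
Proof.
elim: s x y => [|a s IH] x y /=; first by move=> -> ->; rewrite addr0.
move=> [t t0 hx] [u u0 hy]; exists (t + u); first exact: addr_ge0.
by rewrite scalerDl opprD addrACA; apply: IH.
Qed.

Lemma cone_mem s a : a \in s -> cone s a.
Proof.
elim: s => //= b s IH; rewrite inE => /predU1P[->|/IH h].
  by exists 1 => //; rewrite scale1r subrr; apply: cone0.
by exists 0 => //; rewrite scale0r subr0.
Qed.

Lemma cone_polar_le0 s x y : cone s x -> polar s y -> dotv x y <= 0.
Proof.
elim: s x => [|a s IH] x /=; first by move=> -> _; rewrite dotv0l.
move=> [t t0 h] py.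
have := IH _ h (fun b bs => py b (mem_behead (bs : b \in behead (a :: s)))).
rewrite dotvDl dotvNl dotvZl subr_le0 => /le_trans; apply.
by rewrite mulr_ge0_le0 // py // mem_head.
Qed.

Lemma ex_between (I J : eqType) (r : seq I) (r' : seq J)
    (f : I -> R) (g : J -> R) :
  (forall i j, i \in r -> j \in r' -> f i <= g j) ->
  exists t, (forall i, i \in r -> f i <= t) /\ (forall j, j \in r' -> t <= g j).
Proof.
elim: r => [|i r IH] h.
  elim: r' {h} => [|j r' [t [_ IH]]]; first by exists 0.
  exists (Num.min t (g j)); split=> // k; rewrite inE => /predU1P[->|/IH kt].
    by rewrite ge_min lexx orbT.
  by rewrite ge_min kt.
have [|t [h1 h2]] := IH; first by move=> k j kr; apply: h; rewrite inE kr orbT.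
exists (Num.max t (f i)); split=> [k|j jr].
  by rewrite inE => /predU1P[->|/h1 kt]; rewrite le_max ?lexx ?orbT// kt.
by rewrite ge_max h2// h// mem_head.
Qed.

(** The condition on [x] for a solution [t] to exist is that every lower bound
    on [t], coming from a constraint with negative coefficient, is below every
    upper bound: one inequality for each such pair, besides the constraints
    that do not involve [t]. *)
Lemma fourier_motzkin (s : seq (V * R)) : exists s', forall x,
  polar s' x <-> exists t, forall p, p \in s -> dotv p.1 x + p.2 * t <= 0.
Proof.
exists ([seq p.1 | p <- s & p.2 == 0] ++
  [seq p.2 *: u.1 - u.2 *: p.1 | p <- [seq p <- s | 0 < p.2],
                                 u <- [seq u <- s | u.2 < 0]]) => x; split.
  move=> h.
  have [|t [h1 h2]] := @ex_between _ _ [seq p <- s | p.2 < 0]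
    [seq p <- s | 0 < p.2] (fun p => - dotv p.1 x / p.2)
    (fun p => - dotv p.1 x / p.2).
    move=> u p; rewrite !mem_filter => /andP[u0 us] /andP[p0 ps].
    rewrite ler_pdivlMr// mulrAC ler_ndivrMr//.
    have : dotv (p.2 *: u.1 - u.2 *: p.1) x <= 0.
      apply: h; rewrite mem_cat; apply/orP; right.
      by apply: (allpairs_f (fun p u : V * R => p.2 *: u.1 - u.2 *: p.1));
        rewrite mem_filter ?p0 ?u0.
    by rewrite dotvDl dotvNl !dotvZl; lra.
  exists t => p ps; have [p0|p0|p0] := ltgtP p.2 0.
  - have := h1 p; rewrite mem_filter p0 ps => /(_ isT).
    by rewrite ler_ndivrMr//; lra.
  - have := h2 p; rewrite mem_filter p0 ps => /(_ isT).
    by rewrite ler_pdivlMr//; lra.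
  - rewrite p0 mul0r addr0; apply: h; rewrite mem_cat map_f//.
    by rewrite mem_filter p0 eqxx.
move=> [t h] a; rewrite mem_cat => /orP[/mapP[p]|/allpairsP[[p u]]].
  rewrite mem_filter => /andP[/eqP p0 /h]; rewrite p0 mul0r addr0.
  by move=> + ->.
case=> /=; rewrite !mem_filter => /andP[p0 /h hp] /andP[u0 /h hu] ->.
rewrite dotvDl dotvNl !dotvZl.
nra.
Qed.

(** Membership in [cone (a :: s)] asks for a multiplier [t] satisfying the
    inequalities that describe [cone s]; eliminating it leaves inequalities. *)
Lemma cone_is_polar s : exists s', cone s = polar s'.
Proof.
elim: s => [|a s [s' IH]] /=.
  (* The cone of no generator is 0, cut out by the two signs of each coordinate. *)
  exists ([seq delta_mx 0 j | j <- enum 'I_n]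
    ++ [seq - delta_mx 0 j | j <- enum 'I_n]).
  apply/seteqP; split=> [x -> b _|x h]; first by rewrite dotv0r.
  apply: dotv_self_le0; rewrite dotvE.
  suff x0 j : x 0 j = 0 by rewrite big1// => j _; rewrite x0 mul0r.
  have dE : dotv (delta_mx 0 j) x = x 0 j.
    by rewrite /dotv -rowE !mxE.
  apply/eqP; rewrite eq_le -dE; apply/andP; split; last first.
    rewrite -oppr_le0 -dotvNl h// mem_cat; apply/orP; right.
    by apply/mapP; exists j => //; rewrite mem_enum.
  rewrite h// mem_cat; apply/orP; left.
  by apply/mapP; exists j => //; rewrite mem_enum.
have [s2 h2] := fourier_motzkin ((0, -1) :: [seq (d, - dotv d a) | d <- s']).
exists s2; apply/seteqP; split=> x; rewrite IH.
  move=> [t t0 h]; apply/h2; exists t => p.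
  rewrite inE => /predU1P[->|/mapP[d ds ->]] /=; first by rewrite dotv0l; lra.
  by have := h _ ds; rewrite dotvDr dotvNr dotvZr; lra.
move/h2 => [t h]; exists t.
  by have := h _ (mem_head _ _); rewrite dotv0l /=; lra.
move=> d ds; have := h (d, - dotv d a).
rewrite inE map_f ?orbT//= => /(_ isT).
by rewrite dotvDr dotvNr dotvZr; lra.
Qed.

(** Each inequality describing [cone s] holds at the generators, hence its
    normal belongs to [polar s]. *)
Lemma farkas s x : (forall y, polar s y -> dotv x y <= 0) -> cone s x.
Proof.
have [s' e] := cone_is_polar s.
move=> h; rewrite e => d ds; rewrite dotvC; apply: h => a /cone_mem.
by rewrite e => /(_ _ ds); rewrite dotvC.
Qed.

(** With [cone s = polar s'], Farkas' lemma turns the dual description of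
    [polar s] into membership in [cone s']. *)
Lemma polar_is_cone s : exists s', polar s = cone s'.
Proof.
have [s' e] := cone_is_polar s; exists s'; apply/seteqP; split=> y.
  move=> ys; apply: farkas => x; rewrite -e => /cone_polar_le0 /(_ ys).
  by rewrite dotvC.
move=> h a /cone_mem; rewrite e => /(cone_polar_le0 h).
by rewrite dotvC.
Qed.

End Cones.

(** * Closedness of finite unions of finitely generated cones *)

Section Topology.
Variable R : realType.

Lemma cvg_mx (T : Type) (F : set_system T) {FF : Filter F} m n
    (f : T -> 'M[R]_(m, n)) (M : 'M[R]_(m, n)) :
  (forall i j, f t i j @[t --> F] --> M i j) -> f @ F --> M.
Proof.
move=> h A [P MP PA]; apply: filterS (_ : F (fun t => forall i j, P i j (f t i j))).
  by move=> t; apply: PA.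
apply: filter_forall => i; apply: filter_forall => j.
exact: (h i j _ (MP i j)).
Qed.

Lemma cvg_coord (T : Type) (F : set_system T) {FF : Filter F} m n
    (f : T -> 'M[R]_(m, n)) (M : 'M[R]_(m, n)) i j :
  f @ F --> M -> f t i j @[t --> F] --> M i j.
Proof. by move=> h; apply: (cvg_comp _ _ h (@coord_continuous R m n i j M)). Qed.

Lemma cvg_dotv (T : Type) (F : set_system T) {FF : Filter F} n
    (f : T -> 'rV[R]_n) (x y : 'rV[R]_n) :
  f @ F --> x -> dotv y (f t) @[t --> F] --> dotv y x.
Proof.
move=> h; rewrite dotvE; under eq_fun do rewrite dotvE.
apply: cvg_big => [|j _]; first exact: add_continuous.
by apply: cvgM; [exact: cvg_cst|exact: cvg_coord].
Qed.

Lemma cvg_vpair (T : Type) (F : set_system T) {FF : Filter F} n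
    (f : T -> 'rV[R]_n) (g : T -> R) (x : 'rV[R]_n) (c : R) :
  f @ F --> x -> g @ F --> c -> vpair (f t) (g t) @[t --> F] --> vpair x c.
Proof.
move=> hf hg; apply: cvg_mx => i j; rewrite !ord1 /vpair.
case: (split_ordP j) => k ->; last first.
  under eq_fun do rewrite row_mxEr mxE ord1 mulr1n.
  by rewrite row_mxEr mxE ord1 mulr1n.
under eq_fun do rewrite row_mxEl.
by rewrite row_mxEl; apply: cvg_coord.
Qed.

Lemma cvg_lsubmx (T : Type) (F : set_system T) {FF : Filter F} n
    (f : T -> 'rV[R]_(n + 1)) (M : 'rV[R]_(n + 1)) :
  f @ F --> M -> lsubmx (f t) @[t --> F] --> lsubmx M.
Proof.
move=> h; apply: cvg_mx => i j; rewrite mxE; under eq_fun do rewrite mxE.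
exact: cvg_coord.
Qed.

Lemma continuous_dotv n (a : 'rV[R]_n) : continuous (dotv a).
Proof. by move=> x; apply: (@cvg_dotv _ (nbhs x) _ n id); exact: cvg_id. Qed.

Lemma continuous_lsubmx n : continuous (@lsubmx R 1 n 1).
Proof. by move=> w; apply: (@cvg_lsubmx _ (nbhs w) _ n id); exact: cvg_id. Qed.

Lemma closed_dotv_le0 n (a : 'rV[R]_n) : closed [set x | dotv a x <= 0].
Proof.
rewrite (_ : mkset _ = dotv a @^-1` [set t | t <= 0]) //.
by apply: preimage_closed; [move=> x _; exact: continuous_dotv|exact: closed_le].
Qed.

Lemma closed_polar n (s : seq 'rV[R]_n) : closed (polar s).
Proof.
rewrite (_ : polar s = \bigcap_(a in [set` s]) [set x | dotv a x <= 0]) //.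
by apply: closed_bigI => a _; exact: closed_dotv_le0.
Qed.

Lemma closed_exists_mem (T : topologicalType) (I : choiceType) (r : seq I)
    (F : I -> set T) : (forall i, i \in r -> closed (F i)) ->
  closed [set x | exists2 i, i \in r & F i x].
Proof.
move=> cF; rewrite (_ : mkset _ = \big[setU/set0]_(i <- r) F i).
  exact: closed_bigsetU.
by rewrite -bigcup_seq.
Qed.

Definition ucone n (L : seq (seq 'rV[R]_n)) : set 'rV[R]_n :=
  [set x | exists2 s, s \in L & cone s x].

Lemma closed_ucone n (L : seq (seq 'rV[R]_n)) : closed (ucone L).
Proof.
apply: closed_exists_mem => s _.
have [s' ->] := cone_is_polar s; exact: closed_polar.
Qed.

Lemma near_ray n (x d : 'rV[R]_n) (A : set 'rV[R]_n) :
  nbhs x A -> \forall t \near 0^'+, A (x + t *: d).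
Proof.
have : x + t *: d @[t --> (0 : R)^'+] --> x.
  rewrite -[X in _ --> X]addr0 -(scale0r d).
  apply: cvgD; first exact: cvg_cst.
  apply: cvgZr_tmp.
  by apply: cvg_at_right_filter; exact: cvg_id.
exact.
Qed.

End Topology.

(** * Germs of piecewise affine functions and normals to the epigraph *)

Section Germs.
Variables (R : realType) (n : nat).
Local Notation V := 'rV[R]_n.
Implicit Types (psi : V -> \bar R) (D : seq (V * seq V)) (x z zb xi : V).

Lemma dotv_vpair (u v : V) (a b : R) :
  dotv (vpair u a) (vpair v b) = dotv u v + a * b.
Proof.
rewrite /dotv /vpair tr_row_mx mul_row_col mxE; congr (_ + _).
by rewrite tr_scalar_mx -scalar_mxM mxE eqxx mulr1n.
Qed.

Lemma vpairE (w : 'rV[R]_(n + 1)) : w = vpair (lsubmx w) (rsubmx w 0 0).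
Proof. by rewrite /vpair -mx11_scalar hsubmxK. Qed.

Lemma vpairDZ (u v : V) (a b t : R) :
  vpair u a + t *: vpair v b = vpair (u + t *: v) (a + t * b).
Proof.
by rewrite /vpair scale_row_mx add_row_mx scale_scalar_mx raddfD.
Qed.

Lemma lsubmx_vpair (u : V) a : lsubmx (vpair u a) = u.
Proof. exact: row_mxKl. Qed.

Lemma vpair_inj (u v : V) a b : vpair u a = vpair v b -> u = v /\ a = b.
Proof.
by move=> /eq_row_mx[-> /matrixP/(_ 0 0)]; rewrite !mxE !eqxx !mulr1n.
Qed.

(** Each pair [(g, s)] of [D] describes a cone [polar s] of directions at [x]
    along which [psi] is affine with gradient [g]. *)
Definition germ psi (x : V) D : Prop :=
  \forall y \near x, (exists2 p, p \in D & polar p.2 (y - x)) /\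
    forall p, p \in D -> polar p.2 (y - x) ->
      psi y = (fine (psi x) + dotv p.1 (y - x))%:E.

(** For [lam = 1] this is the regular subdifferential of the germ. The
    homogeneous variable [lam] makes it a cone; its points with [lam >= 0] are
    those for which [(xi, - lam)] is a regular normal to the epigraph. *)
Definition germ_slope D (xi : V) (lam : R) : Prop :=
  forall p, p \in D -> forall h, polar p.2 h -> dotv xi h <= lam * dotv p.1 h.

Lemma germ_fin psi x D : germ psi x D -> psi x = (fine (psi x))%:E.
Proof.
by move=> /nbhs_singleton[[p pD pp] /(_ p pD pp)]; rewrite subrr dotv0r addr0.
Qed.

Lemma polarZ (s : seq V) t x : 0 <= t -> polar s x -> polar s (t *: x).
Proof. by move=> t0 h a /h ax; rewrite dotvZr mulr_ge0_le0. Qed.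

Lemma polarZ_inv (s : seq V) t x : 0 < t -> polar s (t *: x) -> polar s x.
Proof.
move=> t0 /(polarZ (t := t^-1)); rewrite scalerA mulVf ?gt_eqF// scale1r.
by apply; rewrite invr_ge0 ltW.
Qed.

(** The pieces containing [x] and their tight inequalities at [x] determine the
    germ at [x], since nothing else matters near [x]: a piece missing [x]
    violates one of its inequalities strictly, and slack inequalities remain
    satisfied. There are finitely many such patterns. *)
Lemma finite_germs psi zb : piecewise_affine_near psi zb ->
  exists DD : seq (seq (V * seq V)),
    \forall x \near zb, exists2 D, D \in DD & germ psi x D.
Proof.
move=> [U nU [N [P [g [b [polP covU affU]]]]]].
have /choice[sys sysE] : forall k,
    exists sys : {m : nat & (('I_m -> V) * ('I_m -> R))%type},
      P k = [set x | forall j, dotv ((tagged sys).1 j) x <= (tagged sys).2 j].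
  move=> k; have [m [A [B ->]]] := polP k.
  by exists (Tagged (fun m => (('I_m -> V) * ('I_m -> R))%type) (A, B)).
pose m k := tag (sys k).
pose A k : 'I_(m k) -> V := (tagged (sys k)).1.
pose B k : 'I_(m k) -> R := (tagged (sys k)).2.
have PE k : P k = [set x | forall j, dotv (A k j) x <= B k j] by exact: sysE.
pose nrm (S : {set {k : 'I_N & 'I_(m k)}}) k :=
  [seq A k j | j <- enum 'I_(m k) & Tagged (fun k => 'I_(m k)) j \in S].
pose mkD (c : {set 'I_N} * {set {k : 'I_N & 'I_(m k)}}) :=
  [seq (g k, nrm c.2 k) | k <- enum 'I_N & k \in c.1].
exists [seq mkD c | c <- enum {: {set 'I_N} * {set {k : 'I_N & 'I_(m k)}}}].
have : \forall x \near zb, nbhs x U by exact: nbhs_interior.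
apply: filterS => x xU.
pose c1 := [set k | `[< P k x >]]%SET.
pose c2 := [set u : {k : 'I_N & 'I_(m k)} |
  dotv (A (tag u) (tagged u)) x == B (tag u) (tagged u)]%SET.
exists (mkD (c1, c2)); first by apply/mapP; exists (c1, c2); rewrite ?mem_enum.
have slack k j (ne : dotv (A k j) x != B k j) :
    \forall y \near x, (dotv (A k j) y <= B k j) = (dotv (A k j) x <= B k j).
  have cA : dotv (A k j) y @[y --> x] --> dotv (A k j) x.
    exact: continuous_dotv.
  have [lt|gt] := boolP (dotv (A k j) x <= B k j).
    have : dotv (A k j) x < B k j by rewrite lt_neqAle ne.
    move=> /(cvgr_lt _ cA); apply: filterS => y; exact: ltW.
  move: gt; rewrite -ltNge => /(cvgr_gt _ cA); apply: filterS => y.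
  by rewrite ltNge => /negbTE.
have near_slack : \forall y \near x, forall k j, dotv (A k j) x != B k j ->
    (dotv (A k j) y <= B k j) = (dotv (A k j) x <= B k j).
  have FF : Filter (nbhs x) by exact: nbhs_filter.
  refine (@filter_forall _ _ (fun k y => forall j, _ -> _ = _) _ FF _) => k.
  refine (@filter_forall _ _ (fun j y => _ -> _ = _) _ FF _) => j.
  have [_|/slack h] := eqVneq (dotv (A k j) x); first exact: filterE.
  by apply: filterS h.
have key : \forall y \near x, forall k,
    P k y <-> P k x /\ polar (nrm c2 k) (y - x).
  apply: filterS near_slack => y sl k; rewrite !PE; split.
    move=> hy; split.
      move=> j /=; have [->//|ne] := eqVneq (dotv (A k j) x) (B k j).
      by rewrite -sl//; apply: hy.
    move=> a /mapP[j]; rewrite mem_filter inE/= => /andP[/eqP ej _] ->.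
    by rewrite dotvDr dotvNr ej subr_le0; apply: hy.
  move=> [hx py] j /=; have [ej|ne] := eqVneq (dotv (A k j) x) (B k j).
    rewrite -ej -subr_le0 -dotvNr -dotvDr; apply: py; apply/mapP; exists j => //.
    by rewrite mem_filter inE/= ej eqxx mem_enum.
  by rewrite sl//; apply: hx.
have xx := nbhs_singleton xU.
rewrite /germ; near=> y.
have Uy : U y by near: y.
have yk : forall k, P k y <-> P k x /\ polar (nrm c2 k) (y - x) by near: y.
split.
  have [k Pky] := covU _ Uy; have /yk[Pkx pk] := Pky.
  exists (g k, nrm c2 k) => //; apply/mapP; exists k => //.
  by rewrite mem_filter inE mem_enum andbT; apply/asboolP.
move=> p /mapP[k]; rewrite mem_filter inE => /andP[/asboolP Pkx _] -> /= pk.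
rewrite (affU k y Uy); last by apply/yk.
by rewrite (affU k x xx Pkx)/= dotvDr dotvNr; congr (_%:E); ring.
Unshelve. all: by end_near.
Qed.

Lemma germ_ray psi x D (h : V) : germ psi x D -> exists2 p, p \in D & polar p.2 h.
Proof.
move=> /(near_ray h) nr.
have [t [[[p pD pp] _] t0]] := filter_ex (filterI nr (nbhs_right_gt (0 : R))).
by exists p => //; apply: polarZ_inv t0 _; rewrite addrC addKr in pp.
Qed.

(** Dividing the defining inequality at [z + t *: d] by [t] bounds [dotv w d]
    by an arbitrarily small multiple of the norm of [d]. *)
Lemma regular_normal_tangent k (A : set 'rV[R]_k) (z w d : 'rV[R]_k) :
  regular_normal_cone A z w -> (\forall t \near 0^'+, A (z + t *: d)) ->
  dotv w d <= 0.
Proof.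
move=> [_ hw] hd; apply/ler_addgt0Pr => e e0; rewrite add0r.
have e1 : 0 < e / (`|d| + 1) by rewrite divr_gt0// ltr_wpDl.
have /(near_ray d) nr := hw _ e1.
have [t [[/= ht At] t0]] :=
  filter_ex (filterI (filterI nr hd) (nbhs_right_gt (0 : R))).
have := ht At; rewrite addrC addKr dotvZr normrZ gtr0_norm//.
rewrite mulrCA ler_pM2l// => /le_trans; apply.
rewrite mulrAC ler_pdivrMr ?ltr_wpDl// ler_pM2l// lerDl//.
Qed.

(** A normal with negative last coordinate can only sit on the graph: above it,
    moving down stays in the epigraph and would force [s <= 0]. On the graph,
    the directions [(h, dotv g h)] of the germ are tangent. *)
Lemma regular_normal_slope psi x D c xi s :
  germ psi x D -> 0 < s ->
  regular_normal_cone (epigraph psi) (vpair x c) (vpair xi (- s)) ->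
  germ_slope D xi s.
Proof.
move=> gD s0 hN; have [[x' [c' [/vpair_inj[<- <-] le_c]]] _] := hN.
move: le_c; rewrite (germ_fin gD) lee_fin le_eqVlt => /orP[/eqP ec|ltc]; last first.
  have : dotv (vpair xi (- s)) (vpair 0 (- 1)) <= 0.
    apply: regular_normal_tangent hN _.
    have : \forall t \near 0^'+, t < c - fine (psi x).
      by apply: nbhs_right_lt; rewrite subr_gt0.
    apply: filterS => t tc; exists x, (c - t); split.
      by rewrite vpairDZ scaler0 addr0 mulrN1.
    by rewrite (germ_fin gD) lee_fin; lra.
  by rewrite dotv_vpair dotv0r; lra.
move=> p pD h ph.
have : dotv (vpair xi (- s)) (vpair h (dotv p.1 h)) <= 0.
  apply: regular_normal_tangent hN _.
  have /(near_ray h) nr := gD.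
  have t0 : \forall t \near (0:R)^'+, 0 < t by exact: nbhs_right_gt.
  apply: filterS2 nr t0 => t [_ /(_ p pD)]; rewrite addrC addKr => hp t0.
  exists (x + t *: h), (c + t * dotv p.1 h); split; first exact: vpairDZ.
  rewrite hp; last by apply: polarZ ph; exact: ltW.
  by rewrite dotvZr -ec lee_fin.
by rewrite dotv_vpair; lra.
Qed.

Lemma slope_regular_normal psi x D xi :
  germ psi x D -> germ_slope D xi 1 ->
  regular_normal_cone (epigraph psi) (vpair x (fine (psi x))) (vpair xi (- 1)).
Proof.
move=> gD sl; split.
  by exists x, (fine (psi x)); split => //; rewrite -(germ_fin gD).
move=> e e0.
have nl : lsubmx @ vpair x (fine (psi x)) --> x.
  by rewrite -[X in _ --> X](lsubmx_vpair x (fine (psi x))); exact: continuous_lsubmx.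
apply: (@filterS _ (nbhs (vpair x (fine (psi x)))) _ _ _ _ (nl _ gD)).
move=> z /= hz [y [c [zE yc]]]; move: hz yc; rewrite zE lsubmx_vpair.
move=> -[[p pD pp] /(_ p pD pp) ->].
rewrite lee_fin => yc.
have -> : vpair y c - vpair x (fine (psi x)) = vpair (y - x) (c - fine (psi x)).
  by rewrite -scaleN1r vpairDZ scaleN1r mulN1r.
rewrite dotv_vpair; apply: (@le_trans _ _ 0); last by rewrite mulr_ge0// ltW.
by have := sl p pD _ pp; lra.
Qed.

End Germs.

(** * Cones over subdifferentials *)

Section Conic.
Variables (R : realType) (n : nat).
Local Notation V := 'rV[R]_n.
Implicit Types (psi : V -> \bar R) (D : seq (V * seq V)) (x z zb xi : V).

Lemma germ_slopeZ D xi lam t :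
  0 <= t -> germ_slope D xi lam -> germ_slope D (t *: xi) (t * lam).
Proof.
by move=> t0 sl p pD h ph; rewrite dotvZl -mulrA ler_wpM2l// sl.
Qed.

(** By Farkas' lemma, [germ_slope D xi lam] says that [xi - lam *: g] lies in
    [cone s] for all [(g, s)] in [D], a system of linear inequalities in
    [(xi, lam)] from which [lam] is eliminated. *)
Lemma slope_cone D : exists s, forall xi,
  cone s xi <-> exists2 lam, 0 <= lam & germ_slope D xi lam.
Proof.
have /choice[q qE] := @cone_is_polar R n.
have slE xi lam : germ_slope D xi lam <->
    forall p, p \in D -> polar (q p.2) (xi - lam *: p.1).
  split=> [sl p pD|sl p pD h ph].
    rewrite -qE; apply: farkas => h ph; rewrite dotvDl dotvNl dotvZl subr_le0.
    exact: sl.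
  have := sl p pD; rewrite -qE => /cone_polar_le0 /(_ ph).
  by rewrite dotvDl dotvNl dotvZl subr_le0.
(* The constraint (0, -1) expresses lam >= 0. *)
have [s sE] := fourier_motzkin ((0, -1) ::
  [seq (d, - dotv d p.1) | p <- D, d <- q p.2]).
have [s' s'E] := polar_is_cone s.
exists s' => xi; rewrite -s'E sE; split.
  move=> [lam h]; exists lam.
    by have := h _ (mem_head _ _); rewrite dotv0l /=; lra.
  apply/slE => p pD d dq; rewrite dotvDr dotvNr dotvZr.
  have := h (d, - dotv d p.1); rewrite inE => /(_ _)/= hh.
  suff : dotv d xi + - dotv d p.1 * lam <= 0 by lra.
  by apply: hh; apply/orP; right; apply: allpairs_f_dep.
move=> [lam lam0 /slE sl]; exists lam => r; rewrite inE.
case/predU1P=> [->|/allpairsPdep[p [d [pD dq ->]]]] /=.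
  by rewrite dotv0l; lra.
by have := sl p pD d dq; rewrite dotvDr dotvNr dotvZr; lra.
Qed.

Definition recurrent_germ psi zb D : Prop :=
  forall A : set V, nbhs zb A -> exists2 x, A x & germ psi x D.

(** Each of the finitely many germs that are not recurrent is avoided on some
    neighbourhood of [zb]. *)
Lemma recurrent_germs psi zb (DD : seq (seq (V * seq V))) :
  exists DD' : seq (seq (V * seq V)),
  (forall D, D \in DD' -> recurrent_germ psi zb D) /\
  \forall x \near zb, forall D, D \in DD -> germ psi x D -> D \in DD'.
Proof.
elim: DD => [|D DD [DD' [rec nz]]].
  by exists [::]; split=> //; apply: filterE.
have [recD|nrecD] := pselect (recurrent_germ psi zb D).
  exists (D :: DD'); split=> [E|].
    by rewrite inE => /predU1P[->|/rec].
  apply: filterS nz => x hx E; rewrite !inE => /predU1P[-> _|EDD gE].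
    by rewrite eqxx.
  by rewrite (hx E EDD gE) orbT.
exists DD'; split=> //.
have [A nA hA] : exists2 A, nbhs zb A & forall x, A x -> ~ germ psi x D.
  apply: contrapT => no; apply: nrecD => A nA; apply: contrapT => nox.
  by apply: no; exists A => // x Ax gx; apply: nox; exists x.
apply: filterS2 nz nA => x hx /hA ngx E; rewrite inE => /predU1P[->//|].
exact: hx.
Qed.

(** Points with germ [D] accumulate at [zb], and the same normal [(xi, -1)]
    serves at all of them. *)
Lemma recurrent_slope_subdiff psi zb D xi :
  fine (psi x) @[x --> zb] --> fine (psi zb) ->
  recurrent_germ psi zb D -> germ_slope D xi 1 -> limiting_subdiff psi zb xi.
Proof.
move=> cpsi rec sl.
have /choice[x_ hx] : forall k : nat,
    exists x, ball zb (k.+1%:R^-1) x /\ germ psi x D.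
  move=> k; have [|x bx gx] := rec (ball zb (k.+1%:R^-1)); last by exists x.
  by apply: nbhsx_ballx; rewrite invr_gt0 ltr0n.
have xcvg : x_ @ \oo --> zb.
  apply/cvg_ballP => e e0; near=> k.
  apply: (@le_ball _ _ _ k.+1%:R^-1); last exact: (hx k).1.
  by apply: ltW; near: k; exact: near_infty_natSinv_lt (PosNum e0).
exists (fun k => vpair (x_ k) (fine (psi (x_ k)))), (fun=> vpair xi (- 1)); split.
- move=> k; exists (x_ k), (fine (psi (x_ k))); split=> //.
  by rewrite -(germ_fin (hx k).2).
- by apply: cvg_vpair => //; exact: cvg_comp xcvg cpsi.
- exact: cvg_cst.
- by move=> k; apply: slope_regular_normal sl; exact: (hx k).2.
Unshelve. all: by end_near.
Qed.

(** The approximating normals [xi_ k] eventually have a negative last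
    coordinate, hence are slopes of one of the germs in [DD]; this is a closed
    condition because [DD] is finite. *)
Lemma subdiff_slope psi z xi (DD : seq (seq (V * seq V))) :
  (\forall x \near z, exists2 D, D \in DD & germ psi x D) ->
  limiting_subdiff psi z xi -> exists2 D, D \in DD & germ_slope D xi 1.
Proof.
move=> nz [w_ [xi_ [_ wcvg xicvg hN]]].
pose H := [set w : 'rV[R]_(n + 1) |
  exists2 D, D \in DD & germ_slope D (lsubmx w) (- rsubmx w 0 0)].
have cH : closed H.
  apply: closed_exists_mem => D _.
  rewrite (_ : (fun w => _) =
    \bigcap_(ph in [set ph : (V * seq V) * V | ph.1 \in D /\ polar ph.1.2 ph.2])
      [set w | dotv (vpair ph.2 (dotv ph.1.1 ph.2)) w <= 0]).
    by apply: closed_bigI => ph _; exact: closed_dotv_le0.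
  apply/seteqP; split=> [w sl [p h] /= [pD ph]|w hw p pD h ph].
    rewrite dotvC [w]vpairE dotv_vpair; have := sl p pD h ph; lra.
  have := hw (p, h) (conj pD ph) => /=.
  rewrite dotvC [w]vpairE dotv_vpair -vpairE; lra.
suff : H (vpair xi (- 1)).
  move=> [D DDD]; rewrite lsubmx_vpair row_mxKr mxE eqxx mulr1n opprK => sl.
  by exists D.
apply: (closed_cvg H cH _ _ xicvg).
have scvg : rsubmx (xi_ k) 0 0 @[k --> \oo] --> (- 1 : R).
  have -> : (fun k => rsubmx (xi_ k) 0 0) = (fun k => xi_ k 0 (rshift n 0)).
    by apply/funext => k; rewrite mxE.
  have := @cvg_coord R _ _ _ _ _ _ _ 0 (rshift n 0) xicvg.
  rewrite row_mxEr mxE eqxx mulr1n; apply; exact: eventually_filter.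
have xcvg : lsubmx (w_ k) @[k --> \oo] --> z.
  rewrite -(lsubmx_vpair z (fine (psi z))).
  exact: cvg_lsubmx.
near=> k.
have sk : rsubmx (xi_ k) 0 0 < 0.
  by near: k; apply: (cvgr_lt _ scvg); lra.
have [D DDD gD] : exists2 D, D \in DD & germ psi (lsubmx (w_ k)) D.
  by near: k; exact: (xcvg _ nz).
exists D => //.
apply: (regular_normal_slope (c := rsubmx (w_ k) 0 0) gD); first by rewrite oppr_gt0.
by rewrite opprK -!vpairE.
Unshelve. all: by end_near.
Qed.

(** Near [zb] the values of [S] generate only rays inside the cone over
    [S zb], and that cone is a finite union of finitely generated cones. The
    second clause asks for some element of [S zb] even at [lam = 0], so the
    cone over an empty set is empty. *)
Definition conic_near (S : V -> set V) zb : Prop :=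
  exists L : seq (seq V),
  (\forall z \near zb, forall v lam, S z v -> 0 <= lam -> ucone L (lam *: v)) /\
  (forall xi, ucone L xi ->
    exists lam v, [/\ 0 <= lam, S zb v & xi = lam *: v]).

(** The directions of a germ cover the whole space, and a linear form that is
    nonpositive everywhere vanishes. This is the boundedness of the regular
    subdifferential, in homogeneous form. *)
Lemma slope0_eq0 psi x D xi : germ psi x D -> germ_slope D xi 0 -> xi = 0.
Proof.
move=> gD sl; apply: dotv_self_le0.
by have [p pD /(sl p pD)] := germ_ray xi gD; rewrite mul0r.
Qed.

(** The cones are those of [slope_cone] for the recurrent germs with a nonempty
    regular subdifferential; a zero multiplier is harmless by
    [slope0_eq0]. *)
Lemma conic_limiting psi zb :
  fine (psi x) @[x --> zb] --> fine (psi zb) ->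
  piecewise_affine_near psi zb -> conic_near (limiting_subdiff psi) zb.
Proof.
move=> cpsi /finite_germs[DD nDD].
have [DD' [rec nz]] := recurrent_germs psi zb DD.
have /choice[gen genE] := slope_cone.
pose DS := [seq D <- DD' | `[< exists xi, germ_slope D xi 1 >]].
exists (map gen DS); split.
  have : \forall x \near zb, exists2 D, D \in DD' & germ psi x D.
    by apply: filterS2 nDD nz => x [D DDD gD] hx; exists D => //; exact: hx.
  move=> /nbhs_interior; apply: filterS => z nbz v lam /(subdiff_slope nbz).
  move=> [D DD'D sl] lam0; exists (gen D).
    apply/mapP; exists D => //; rewrite mem_filter DD'D andbT.
    by apply/asboolP; exists v.
  by apply/genE; exists lam => //; rewrite -[X in germ_slope _ _ X]mulr1;
    apply: germ_slopeZ.
move=> xi [_ /mapP[D + ->]]; rewrite mem_filter => /andP[/asboolP[xi0 sl0] /rec recD].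
move=> /genE[lam]; rewrite le_eqVlt => /predU1P[<-|lam0] sl.
  exists 0, xi0; split=> //; first exact: recurrent_slope_subdiff sl0.
  have [x _ gx] := recD _ filterT.
  by rewrite scale0r; apply: slope0_eq0 gx sl.
exists lam, (lam^-1 *: xi); split; first exact: ltW.
  apply: (recurrent_slope_subdiff cpsi recD).
  rewrite -(mulVf (x := lam)) ?gt_eqF//; apply: germ_slopeZ sl.
  by rewrite invr_ge0 ltW.
by rewrite scalerA divff ?gt_eqF// scale1r.
Qed.

Lemma ucone_sumrays (S : set V) (L : seq (seq V)) x :
  (forall xi, ucone L xi -> exists lam v, [/\ 0 <= lam, S v & xi = lam *: v]) ->
  cone (flatten L) x ->
  exists m (t : 'I_m -> R) (s : 'I_m -> V),
    [/\ forall j, 0 <= t j, forall j, S (s j) & x = \sum_j t j *: s j].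
Proof.
elim: L x => [|c L IH] x hL /=.
  move=> ->; exists 0%N, (fun=> 0), (fun=> 0).
  by split=> [[]//|[]//|]; rewrite big_ord0.
move=> /cone_cat[y [z [cy cz ->]]].
have [|m [t [s [t0 Ss ->]]]] := IH z _ cz.
  by move=> xi [r rL cr]; apply: hL; exists r => //; rewrite inE rL orbT.
have [|lam [v [lam0 Sv ->]]] := hL y; first by exists c => //; exact: mem_head.
exists m.+1, (fun j => oapp t lam (unlift ord0 j)),
  (fun j => oapp s v (unlift ord0 j)).
split=> [j|j|]; [by case: unliftP => /=|by case: unliftP => /=|].
rewrite big_ord_recl unlift_none; congr (_ + _).
by apply: eq_bigr => j _; rewrite liftK.
Qed.

(** The cone over the convex hull is the sum of all the cones of the union,
    that is the cone generated by all their generators together. The empty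
    union is apart: its hull is empty while the sum of no cone is 0. *)
Lemma conic_conv_hull (S : V -> set V) zb :
  conic_near S zb -> conic_near (fun z => conv_hull (S z)) zb.
Proof.
move=> [L [nz hL]].
have [L0|L0] := eqVneq L [::].
  subst L.
  exists [::]; split=> [|xi [s //]].
  apply: filterS nz => z hz v lam [[|m] [t [s [_ + Ss _]]]] _.
    by rewrite big_ord0 => /esym/eqP; rewrite oner_eq0.
  by have [s' //] := hz _ 0 (Ss ord0) (lexx _).
exists [:: flatten L]; split.
  apply: filterS nz => z hz _ lam [m [t [s [t0 _ Ss ->]]]] lam0.
  exists (flatten L); first exact: mem_head.
  rewrite scaler_sumr; apply: big_ind => [|x y|j _]; [exact: cone0|exact: coneD|].
  rewrite scalerA; have [|c] := hz _ (lam * t j) (Ss j); first exact: mulr_ge0.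
  elim: L {L0 hL hz} => // c' L IH; rewrite inE => /predU1P[->|cL] cc.
    apply/cone_cat; exists (lam * t j *: s j), 0.
    by split=> //; [exact: cone0|rewrite addr0].
  apply/cone_cat; exists 0, (lam * t j *: s j).
  by split=> //; [exact: cone0|exact: IH|rewrite add0r].
move=> xi [_ /[!inE] /eqP-> /(ucone_sumrays hL)[m [t [s [t0 Ss ->]]]]].
have sum_ge0 : 0 <= \sum_j t j by apply: sumr_ge0.
have [sum0|sumN0] := eqVneq (\sum_j t j) 0.
  have [c cL] : exists c, c \in L.
    by case: (L) L0 => // c L' _; exists c; exact: mem_head.
  have [|_ [v [_ Sv _]]] := hL 0; first by exists c => //; exact: cone0.
  exists 0, v; split=> //.
    exists 1%N, (fun=> 1), (fun=> v); split=> //; first by rewrite big_ord1.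
    by rewrite big_ord1 scale1r.
  rewrite scale0r big1// => j _.
  have /eqP := sum0; rewrite psumr_eq0// => /allP/(_ j (mem_index_enum _))/eqP ->.
  by rewrite scale0r.
exists (\sum_j t j), (\sum_j (t j / \sum_j t j) *: s j); split=> //.
  exists m, (fun j => t j / \sum_j t j), s; split=> //.
    by move=> j; exact: divr_ge0.
  by rewrite -mulr_suml divff.
rewrite scaler_sumr; apply: eq_bigr => j _.
by rewrite scalerA mulrCA divff// mulr1.
Qed.

Lemma conic_union (S1 S2 : V -> set V) zb :
  conic_near S1 zb -> conic_near S2 zb ->
  conic_near (fun z => S1 z `|` S2 z) zb.
Proof.
move=> [L1 [n1 h1]] [L2 [n2 h2]]; exists (L1 ++ L2); split.
  apply: filterS2 n1 n2 => z hz1 hz2 v lam [/hz1 hv|/hz2 hv] /hv[s sL cs];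
  by exists s => //; rewrite mem_cat sL ?orbT.
move=> xi [s]; rewrite mem_cat => /orP[sL|sL] cs.
  have [|lam [v [? ? ?]]] := h1 xi; first by exists s.
  by exists lam, v; split=> //; left.
have [|lam [v [? ? ?]]] := h2 xi; first by exists s.
by exists lam, v; split=> //; right.
Qed.

Definition uconeD (L1 L2 : seq (seq V)) := [seq s ++ t | s <- L1, t <- L2].

Lemma uconeDP L1 L2 x : ucone (uconeD L1 L2) x <->
  exists y z, [/\ ucone L1 y, ucone L2 z & x = y + z].
Proof.
split=> [[_ /allpairsP[[s t] /= [sL tL ->]]] /cone_cat[y [z [cy cz ->]]]|].
  by exists y, z; split=> //; [exists s|exists t].
move=> [y [z [[s sL cs] [t tL ct] ->]]]; exists (s ++ t).
  exact: allpairs_f.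
by apply/cone_cat; exists y, z.
Qed.

(** Distributing the sum over the unions gives sums of finitely generated
    cones, which concatenate their generators. As [r] has no repetition,
    the summands can be indexed by a function. *)
Lemma ucone_sum (I : eqType) (r : seq I) (P : pred I) (L : I -> seq (seq V)) :
  uniq r -> exists L', forall x, ucone L' x <->
  exists w : I -> V, (forall i, i \in r -> P i -> ucone (L i) (w i)) /\
    x = \sum_(i <- r | P i) w i.
Proof.
elim: r => [_|i r IH /= /andP[ir /IH[L' hL']]].
  exists [:: [::]] => x; split=> [[s /[!inE] /eqP-> /= ->]|[w [_ ->]]].
    by exists (fun=> 0); split=> //; rewrite big_nil.
  by rewrite big_nil; exists [::] => //; exact: cone0.
have [Pi|nPi] := boolP (P i); last first.
  exists L' => x; split=> [/hL'[w [hw ->]]|[w [hw ->]]].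
    exists w; split; last by rewrite big_cons (negbTE nPi).
    move=> j; rewrite inE => /predU1P[->|/hw//]; by rewrite (negbTE nPi).
  apply/hL'; exists w; split; last by rewrite big_cons (negbTE nPi).
  by move=> j jr; apply: hw; rewrite inE jr orbT.
exists (uconeD (L i) L') => x; split.
  move=> /uconeDP[y [z [cy /hL'[w [hw ->]] ->]]].
  exists (fun j => if j == i then y else w j); split.
    move=> j; rewrite inE; have [->//|_ /= jr] := eqVneq j i.
    exact: hw.
  rewrite big_cons Pi eqxx; congr (_ + _).
  rewrite [LHS]big_seq_cond [RHS]big_seq_cond.
  apply: eq_bigr => j /andP[jr _]; case: eqVneq jr => // ->.
  by rewrite (negbTE ir).
move=> [w [hw ->]]; apply/uconeDP.
exists (w i), (\sum_(j <- r | P j) w j); split.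
- by apply: hw => //; exact: mem_head.
- apply/hL'; exists w; split=> // j jr; apply: hw; by rewrite inE jr orbT.
- by rewrite big_cons Pi.
Qed.

End Conic.

(** * Asymptotic regularity *)

Section Regularity.
Variables (R : realType) (n : nat).
Local Notation V := 'rV[R]_n.

Lemma pwa_opp (psi : V -> \bar R) (zb : V) :
  piecewise_affine_near psi zb ->
  piecewise_affine_near (fun x => - psi x)%E zb.
Proof.
move=> [U nU [N [P [a [b [polP covU affU]]]]]].
exists U => //; exists N, P, (fun k => - a k), (fun k => - b k); split=> // k x Ux Px.
by rewrite (affU k x Ux Px) -EFinN dotvNl opprD.
Qed.

Lemma lipschitz_fine_cvg (psi : V -> \bar R) (zb : V) :
  locally_lipschitz_at psi zb -> fine (psi x) @[x --> zb] --> fine (psi zb).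
Proof.
move=> [U nU [_ lipU]]; apply/(@cvgrPdist_le _ _ _ (nbhs zb)) => e e0.
have [M M0 hM] : exists2 M : R, 0 < M &
    forall x y, U x -> U y -> `|fine (psi x) - fine (psi y)| <= M * `|x - y|.
  have [M [M0 h]] := filter_ex (filterI (nbhs_pinfty_gt (num_real (0 : R))) lipU).
  by exists M => // x y Ux Uy; exact: (h (x, y)).
have Uzb := nbhs_singleton nU.
have nb : nbhs zb (ball zb (e / M)) by apply: nbhsx_ballx; exact: divr_gt0.
apply: filterS2 nU nb => x Ux.
rewrite -ball_normE /= => bx; apply: le_trans (hM _ _ Uzb Ux) _.
by rewrite mulrC -ler_pdivlMr// ltW.
Qed.

(** The multiplier set is a Minkowski sum of cones over subdifferentials, so at
    nearby points it is contained in a closed set that equals it at [zb]. *)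
Lemma asymptotically_regular_conic p q (phi : 'I_(p + q).+1 -> V -> \bar R)
    (sd : (V -> \bar R) -> V -> set V) (zb : V) :
  (forall i, active_index phi zb i -> conic_near (sd (phi i)) zb) ->
  (forall i, eq_index i ->
     conic_near (fun z => sd (phi i) z `|` sd (fun x => - phi i x)%E z) zb) ->
  asymptotically_regular phi sd zb.
Proof.
move=> hact heq xi [z_ [xi_ [_ zcvg xicvg hM]]].
pose S i z := if eq_index i then sd (phi i) z `|` sd (fun x => - phi i x)%E z
              else sd (phi i) z.
pose P i := active_index phi zb i || eq_index i.
(* The two sums of Mbar range over disjoint indices, hence form a single one. *)
have excl i : active_index phi zb i -> eq_index i = false.
  by rewrite /active_index /ineq_index /eq_index =>
    /andP[/andP[_]]; rewrite leqNgt => /negbTE.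
have /choice[L hL] : forall i, exists L : seq (seq V), P i ->
    (\forall z \near zb, forall v lam, S i z v -> 0 <= lam -> ucone L (lam *: v)) /\
    (forall xi, ucone L xi ->
      exists lam v, [/\ 0 <= lam, S i zb v & xi = lam *: v]).
  move=> i; rewrite /P /S; have [ei|nei] := boolP (eq_index i).
    by have [L hL] := heq _ ei; exists L.
  have [ai|_] := boolP (active_index phi zb i); last by exists [::].
  by have [L hL] := hact _ ai; exists L.
have MbarP z x : Mbar phi sd zb z x <-> exists lam v,
    [/\ forall i, P i -> 0 <= lam i, forall i, P i -> S i z (v i) &
        x = \sum_(i | P i) lam i *: v i].
  have sumE (w : 'I_(p + q).+1 -> V) : \sum_(i | P i) w i =
      \sum_(i | active_index phi zb i) w i + \sum_(i | eq_index i) w i.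
    rewrite (bigID (@eq_index p q))/= addrC; congr (_ + _); apply: eq_bigl => i.
      by rewrite /P; case: (boolP (active_index phi zb i)) => [/excl->|_]//=;
        case: eq_index.
    by rewrite /P; case: eq_index; rewrite ?orbT ?andbT ?andbF.
  split=> [[lam [v [l0 va ve ->]]]|[lam [v [l0 vS ->]]]]; exists lam, v.
    split=> // i; rewrite /P /S.
    by case: (boolP (eq_index i)) => [/ve//|_]; rewrite orbF => /va.
  split=> // i ii.
    by have := vS i; rewrite /P /S ii excl//; exact.
  by have := vS i; rewrite /P /S ii orbT; exact.
have [L' hL'] := @ucone_sum R n _ (index_enum 'I_(p + q).+1) P L (index_enum_uniq _).
have : ucone L' xi.
  apply: (closed_cvg _ (@closed_ucone R n L') _ _ xicvg).
  have : \forall z \near zb, forall i, P i -> forall v lam,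
      S i z v -> 0 <= lam -> ucone (L i) (lam *: v).
    refine (@filter_forall _ _ (fun i z => P i -> forall v lam,
      S i z v -> 0 <= lam -> ucone (L i) (lam *: v)) _ (nbhs_filter zb) _) => i.
    have [Pi|nPi] := boolP (P i); last exact: filterE.
    by apply: filterS (hL i Pi).1 => z hz _.
  move=> /zcvg nk; refine (@filterS _ \oo _ _ _ _ nk) => k hk.
  have /MbarP[lam [v [l0 vS ->]]] := hM k.
  apply/hL'; exists (fun i => lam i *: v i); split=> // i _ Pi.
  by apply: hk => //; [exact: vS|exact: l0].
move=> /hL'[w [hw ->]]; apply/MbarP.
have /choice[lv lvE] : forall i, exists lv : R * V, P i ->
    [/\ 0 <= lv.1, S i zb lv.2 & w i = lv.1 *: lv.2].
  move=> i; have [Pi|nPi] := boolP (P i); last by exists (0, 0).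
  have [lam [v hv]] := (hL i Pi).2 _ (hw i (mem_index_enum _) Pi).
  by exists (lam, v).
exists (fun i => (lv i).1), (fun i => (lv i).2); split.
- by move=> i /lvE[].
- by move=> i /lvE[].
- by apply: eq_bigr => i /lvE[].
Qed.

End Regularity.

Theorem lemma3p13 (R : realType) (n p q : nat)
    (phi : 'I_(p + q).+1 -> 'rV[R]_n -> \bar R) (zb : 'rV[R]_n)
    (hfeas : feasible phi zb)
    (hlip : forall i : 'I_(p + q).+1,
        \forall z \near zb, locally_lipschitz_at (phi i) z)
    (hpwa : forall i : 'I_(p + q).+1,
        active_index phi zb i || eq_index i ->
        piecewise_affine_near (phi i) zb) :
  asymptotically_regular phi (@limiting_subdiff R n) zb
  /\ asymptotically_regular phi (@clarke_subdiff R n) zb.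
Proof.
have cvg_phi i : fine (phi i x) @[x --> zb] --> fine (phi i zb).
  exact: lipschitz_fine_cvg (nbhs_singleton (hlip i)).
have cvg_oppphi i : fine (- phi i x)%E @[x --> zb] --> fine (- phi i zb)%E.
  by rewrite fineN; under eq_fun do rewrite fineN; exact: cvgN (cvg_phi i).
have lim_phi i : active_index phi zb i || eq_index i ->
    conic_near (limiting_subdiff (phi i)) zb.
  by move=> /hpwa; exact: conic_limiting.
have lim_oppphi i : active_index phi zb i || eq_index i ->
    conic_near (limiting_subdiff (fun x => - phi i x)%E) zb.
  by move=> /hpwa/pwa_opp; exact: conic_limiting.
split; apply: asymptotically_regular_conic => i ii.
- by apply: lim_phi; rewrite ii.
- by apply: conic_union; [apply: lim_phi|apply: lim_oppphi]; rewrite ii orbT.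
- by apply: conic_conv_hull; apply: lim_phi; rewrite ii.
- by apply: conic_union; apply: conic_conv_hull;
    [apply: lim_phi|apply: lim_oppphi]; rewrite ii orbT.
Qed.
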